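(* Let $k$ be a field, $m\geq 2$, and let $X=\{x_{i,j}\mid 1\leq i,j\leq m\}$ be the set of entries of the $m\times m$ generic matrix over $k$. Let $X=X_1\cup X_2$ be a decomposition into disjoint sets. Let $L=(\ell_{i,j})$ be an $m\times m$ matrix such that each entry $\ell_{i,j}$ is either an element of $X_1$ or a (possibly zero) linear form in the polynomial ring $k[X_2]$. Let $Z\subset X$ be the set of variables effectively occurring in the entries of $L$, and let $A=k[Z]$. Assume that: (a) $f:=\det L\neq 0$; (b) some $(m-1)\times(m-1)$ minor of $L$ is regular over $A/(f)$; (c) for any two entries $\ell_{i,j},\ell_{i',j'}$ of $L$ contained in $X_1$ with $(i,j)\neq(i',j')$, one has $\ell_{i,j}\neq\ell_{i',j'}$. Let $\{y_z\mid z\in Z\}$ be new (dual) variables and let $\partial: k[y_z\mid z\in Z]\to A/(f)$ be the $k$-algebra map with $y_z\mapsto \partial f/\partial z \pmod f$. Then, for all $1\leq i<i'\leq m$ and $1\leq j<j'\leq m$ such that the four entries $\ell_{i,j},\ell_{i,j'},\ell_{i',j},\ell_{i',j'}$ all belong to $X_1$, the $2\times 2$ minor $$y_{\ell_{i,j}}\,y_{\ell_{i',j'}}-y_{\ell_{i,j'}}\,y_{\ell_{i',j}}$$ belongs to $\ker\partial$. In other words, the ideal generated by all $2\times 2$ minors of $L$, read in the dual variables, whose entries are variables dual to elements of $X_1$, is contained in $\ker \partial$.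
   Context: The generic matrix is the matrix whose entries are independent indeterminates $x_{i,j}$ over $k$. An element $a\in A$ is regular over $A/(f)$ if multiplication by $a$ on $A/(f)$ is injective. *)

(* Defs.v *)
From HB Require Import structures.
From mathcomp Require Import all_boot all_order all_algebra.
From mathcomp Require Import generic_quotient ring_quotient.
From mathcomp.classical Require Import boolp.
From mathcomp.multinomials Require Import mpoly.

Set Implicit Arguments.
Unset Strict Implicit.
Unset Printing Implicit Defensive.

Import GRing.Theory.

Local Open Scope ring_scope.
Local Open Scope quotient_scope.

Definition principal (A : comNzRingType) (f : A) : {pred A} :=
  fun a => `[< exists b, a = b * f >].

Lemma principalP (A : comNzRingType) (f a : A) :
  reflect (exists b, a = b * f) (a \in principal f).
Proof. exact: asboolP. Qed.

Fact principal_zmod_closed (A : comNzRingType) (f : A) :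
  zmod_closed (principal f).
Proof.
split; first by apply/principalP; exists 0; rewrite mul0r.
move=> _ _ /principalP[a ->] /principalP[b ->].
by apply/principalP; exists (a - b); rewrite mulrBl.
Qed.

HB.instance Definition _ (A : comNzRingType) (f : A) :=
  GRing.isZmodClosed.Build A (principal f) (principal_zmod_closed f).

(* [{ideal_quot I}] only carries a ring structure for proper ideals [I].
   Here [A/(f)] is a possibly zero commutative ring, for every [f]. *)
Definition quo (A : comNzRingType) (f : A) := Quotient.quot (principal f).

HB.instance Definition _ (A : comNzRingType) (f : A) :=
  GRing.Zmodule.on (quo f).

Section QuotientRing.
Variables (A : comNzRingType) (f : A).

Definition quo_class (a : A) : quo f := \pi_(Quotient.quot (principal f)) a.

Fact quo_classE (a b : A) :
  (quo_class a == quo_class b) = (a - b \in principal f).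
Proof. by rewrite /quo_class -Quotient.idealrBE. Qed.

Definition quo_rep (x : quo f) : A := repr (x : Quotient.quot (principal f)).

Fact quo_repK : cancel quo_rep quo_class.
Proof. by move=> x; rewrite /quo_class /quo_rep reprK. Qed.

Fact quo_class_is_zmod_morphism : zmod_morphism quo_class.
Proof. by move=> a b; rewrite /quo_class raddfB. Qed.

HB.instance Definition _ :=
  GRing.isZmodMorphism.Build A (quo f) quo_class quo_class_is_zmod_morphism.

Definition quo_one : quo f := quo_class 1.
Definition quo_mul (x y : quo f) : quo f := quo_class (quo_rep x * quo_rep y).

Fact quo_class_mul : {morph quo_class : a b / a * b >-> quo_mul a b}.
Proof.
move=> a b; apply/eqP; rewrite quo_classE.
have rep c : exists d, c - quo_rep (quo_class c) = d * f.
  by apply/principalP; rewrite -quo_classE quo_repK.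
have [[c ac] [d bd]] := (rep a, rep b); apply/principalP.
exists (c * b + quo_rep (quo_class a) * d).
by rewrite mulrDl mulrAC -ac -(mulrA _ d) -bd mulrBl mulrBr addrA subrK.
Qed.

Fact quo_mulA : associative quo_mul.
Proof.
move=> x y z; rewrite -[x]quo_repK -[y]quo_repK -[z]quo_repK.
by rewrite -!quo_class_mul mulrA.
Qed.

Fact quo_mulC : commutative quo_mul.
Proof. by move=> x y; rewrite /quo_mul mulrC. Qed.

Fact quo_mul1 : left_id quo_one quo_mul.
Proof.
by move=> x; rewrite -[x in LHS]quo_repK -quo_class_mul mul1r quo_repK.
Qed.

Fact quo_mulDl : left_distributive quo_mul +%R.
Proof.
move=> x y z; rewrite -[x]quo_repK -[y]quo_repK -[z]quo_repK.
by rewrite -raddfD -!quo_class_mul mulrDl raddfD.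
Qed.

HB.instance Definition _ := GRing.Zmodule_isComPzRing.Build (quo f)
  quo_mulA quo_mulC quo_mul1 quo_mulDl.

Fact quo_class_is_monoid_morphism : monoid_morphism quo_class.
Proof. by split=> // a b; apply: quo_class_mul. Qed.

HB.instance Definition _ :=
  GRing.isMonoidMorphism.Build A (quo f) quo_class quo_class_is_monoid_morphism.

Lemma quo_class_eq0 (a : A) : quo_class a = 0 <-> exists b, a = b * f.
Proof.
rewrite -[0](raddf0 quo_class); split=> [/eqP|[b ->]].
  by rewrite quo_classE subr0 => /principalP.
by apply/eqP; rewrite quo_classE subr0; apply/principalP; exists b.
Qed.

End QuotientRing.

Definition regular_mod (A : comNzRingType) (f a : A) : Prop :=
  injective (fun x : quo f => quo_class f a * x).

Definition ideal_gen (A : comNzRingType) (S : A -> Prop) (p : A) : Prop :=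
  exists n (c g : 'I_n -> A), (forall i, S (g i)) /\ p = \sum_i c i * g i.

Section Variables.
Variables (k : fieldType) (T : finType).

(* [k[X]] for the family of variables [X] indexed by [T] is
   [{mpoly k[#|T|]}], and [k[Z]] for [Z : {set T}] is [{mpoly k[#|Z|]}];
   [enum_rank] and [enum_val] match variable numbers with elements of [T]. *)
Definition xvar (z : T) : {mpoly k[#|T|]} := 'X_(enum_rank z).

Definition vars (p : {mpoly k[#|T|]}) : {set T} :=
  [set z | has (fun m : 'X_{1..#|T|} => m (enum_rank z) != 0%N) (msupp p)].

Definition variable_in (X1 : {set T}) (p : {mpoly k[#|T|]}) : bool :=
  p \in [seq xvar z | z in X1].

Definition linear_form_in (X2 : {set T}) (p : {mpoly k[#|T|]}) : bool :=
  (p \is 1.-homog) && (vars p \subset X2).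

(* The variable of [{mpoly k[#|Z|]}] attached to [z];
   it has the junk value 0 for [z] outside of [Z]. *)
Definition zvar (Z : {set T}) (z : T) : {mpoly k[#|Z|]} :=
  if [pick t : 'I_#|Z| | enum_val t == z] is Some t then 'X_t else 0.

Lemma zvarE (Z : {set T}) (t : 'I_#|Z|) : zvar Z (enum_val t) = 'X_t.
Proof.
rewrite /zvar; case: pickP => [u /eqP/enum_val_inj->//|/(_ t)].
by rewrite eqxx.
Qed.

Definition zincl (Z : {set T}) (p : {mpoly k[#|Z|]}) : {mpoly k[#|T|]} :=
  p \mPo [tuple xvar (enum_val t) | t < #|Z|].

(* Sends the variables outside of [Z] to 0; it is only applied to polynomials
   in the variables of [Z], where it inverts the inclusion of [k[Z]] in [k[X]]
   (lemma [zrestrK]). *)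
Definition zrestr (Z : {set T}) (p : {mpoly k[#|T|]}) : {mpoly k[#|Z|]} :=
  p \mPo [tuple zvar Z (enum_val s) | s < #|T|].

Lemma zrestrK (Z : {set T}) (p : {mpoly k[#|T|]}) :
  vars p \subset Z -> zincl (zrestr Z p) = p.
Proof.
move=> /subsetP pZ; rewrite /zrestr comp_mpolyEX [RHS]mpolyE /zincl raddf_sum.
apply: eq_big_seq => m m_p; rewrite /= comp_mpolyZ comp_mpolyX rmorph_prod.
rewrite [X in _ = _ *: X]mpolyXE_id; congr (_ *: _); apply: eq_bigr => s _.
rewrite rmorphXn tnth_mktuple /=; have [->|ms] := eqVneq (m s) 0%N.
  by rewrite !expr0.
congr (_ ^+ _); have sZ : enum_val s \in Z.
  by apply: pZ; rewrite inE; apply/hasP; exists m; rewrite ?enum_valK.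
have <- := enum_rankK_in sZ sZ.
rewrite zvarE comp_mpolyXU -tnth_nth tnth_mktuple enum_rankK_in //.
by rewrite /xvar enum_valK.
Qed.

End Variables.

Section DualMap.
Variables (k : fieldType) (n : nat) (f : {mpoly k[n]}).

(* The k-algebra map that sends the t-th variable to the class of df/dx_t. *)
Definition polar (P : {mpoly k[n]}) : quo f :=
  quo_class f (P \mPo [tuple f^`M(t) | t < n]).

HB.instance Definition _ := GRing.RMorphism.copy polar
  (quo_class f \o comp_mpoly [tuple f^`M(t) | t < n]).

Lemma polarX (t : 'I_n) : polar 'X_t = quo_class f f^`M(t).
Proof. by rewrite /polar comp_mpolyXU -tnth_nth tnth_mktuple. Qed.

Lemma polarC (c : k) : polar c%:MP = quo_class f c%:MP.
Proof. by rewrite /polar comp_mpolyC. Qed.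

End DualMap.

Section LinearMatrix.
Variables (k : fieldType) (m : nat).
Local Notation T := ('I_m * 'I_m)%type.
Variable L : 'M[{mpoly k[#|{: T}|]}]_m.

Definition occurring : {set T} := \bigcup_i \bigcup_j vars (L i j).

(* The matrix [L] with its entries seen in [A = k[Z]]. *)
Definition restr_mx : 'M[{mpoly k[#|occurring|]}]_m :=
  map_mx (zrestr occurring) L.

Lemma restr_mxK : map_mx (@zincl k _ occurring) restr_mx = L.
Proof.
apply/matrixP=> i j; rewrite !mxE zrestrK //.
by rewrite /occurring; apply: subset_trans (bigcup_sup i _) => //;
  apply: (bigcup_sup j).
Qed.

(* The 2 x 2 minors of [L], in the dual variables, all of whose entries are
   dual to variables indexed by [X1]. *)
Definition dual_minor (X1 : {set T}) (P : {mpoly k[#|occurring|]}) : Prop :=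
  exists (i i' j j' : 'I_m) (z11 z12 z21 z22 : T),
    [/\ (i < i')%N /\ (j < j')%N,
        [/\ z11 \in X1, z12 \in X1, z21 \in X1 & z22 \in X1],
        [/\ L i j = xvar k z11, L i j' = xvar k z12,
            L i' j = xvar k z21 & L i' j' = xvar k z22] &
        P = zvar k occurring z11 * zvar k occurring z22
            - zvar k occurring z12 * zvar k occurring z21].

End LinearMatrix.

(* Main.v *)
Require Import Defs.
From HB Require Import structures.
From mathcomp Require Import all_boot all_order all_algebra.
From mathcomp.multinomials Require Import mpoly.

Set Implicit Arguments.
Unset Strict Implicit.
Unset Printing Implicit Defensive.

Import GRing.Theory.

Local Open Scope ring_scope.

(** A variable [z] of [X1] that is an entry of [L] appears nowhere else in [L]:
    the other entries that are variables of [X1] differ from [z] by (c), and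
    linear forms in [X2] avoid [X1].  Expanding [f = \det L] along the row of
    [z] thus shows that [f^`M(z)] is the cofactor of [L] at the position of [z]
    ([mderiv_det_single], [mderiv_restr_mx]), and a 2 x 2 minor of [L] in dual
    variables is sent by [polar f] to a 2 x 2 minor of the matrix of cofactors.
    By Jacobi's identity such a minor is a multiple of [\det L = f]
    ([det_dvd_adj_minor]), so its class in the quotient by [f] is 0.

    Jacobi's identity is obtained from the product of [L] with the identity
    matrix in which some columns are replaced by columns of [\adj L]: in the
    product each of these columns is a multiple of [\det L], while the determinant of
    the right factor is the minor of [\adj L] ([det_mul_adj_minor]).  As
    [\det L] is nonzero in an integral domain, one factor cancels. *)

(** Both sides are the determinant of [block_mx 1 (- U) V 1], which can be
    triangularized from either diagonal block. *)
Lemma det_add1_mulmxC (R : comNzRingType) (m n : nat)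
    (U : 'M[R]_(m, n)) (V : 'M[R]_(n, m)) :
  \det (1%:M + U *m V) = \det (1%:M + V *m U).
Proof.
have l : block_mx 1%:M (- U) V 1%:M =
    block_mx (1%:M + U *m V) (- U) 0 1%:M *m block_mx 1%:M 0 V 1%:M.
  by rewrite mulmx_block !(mulmx1, mulmx0, mul0mx, mul1mx, add0r, addr0)
    mulNmx addrK.
have r : block_mx 1%:M (- U) V 1%:M =
    block_mx 1%:M 0 V 1%:M *m block_mx 1%:M (- U) 0 (1%:M + V *m U).
  by rewrite mulmx_block !(mulmx1, mulmx0, mul0mx, mul1mx, add0r, addr0)
    mulmxN addrC addrK.
have := congr1 determinant l; rewrite {}r !det_mulmx !det_ublock !det_lblock.
by rewrite !det1 !mulr1 !mul1r.
Qed.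

(** The matrix [M] below is the identity with its columns [q c] replaced by
    the columns [p c] of [\adj A]; written as [1%:M + U *m V], its determinant
    is read off [1%:M + V *m U], which is the minor of [\adj A]. *)
Lemma det_mul_adj_minor (R : comNzRingType) (m n : nat) (A : 'M[R]_m)
    (p q : 'I_n -> 'I_m) : injective q ->
  exists c, \det A * \det (mxsub q p (\adj A)) = c * \det A ^+ n.
Proof.
move=> q_inj; set d := \det A.
pose U : 'M[R]_(m, n) := \matrix_(r, c) ((\adj A) r (p c) - (r == q c)%:R).
pose V : 'M[R]_(n, m) := \matrix_(c, s) (q c == s)%:R.
pose M := 1%:M + U *m V.
(* Since [A *m \adj A = d%:M], the columns of [A *m M] are [d] times basis
   vectors in the positions [q c], and columns of [A] elsewhere. *)
pose N : 'M[R]_m := \matrix_(r, s)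
  if [pick c | q c == s] is Some c then (r == p c)%:R else A r s.
pose D : 'rV[R]_m := \row_s if s \in codom q then d else 1.
have detM : \det M = \det (mxsub q p (\adj A)).
  rewrite /M det_add1_mulmxC; congr (\det _); apply/matrixP=> a b; rewrite !mxE.
  rewrite (bigD1 (q a)) //= big1 => [|r /negPf qar]; last first.
    by rewrite !mxE eq_sym qar mul0r.
  by rewrite !mxE eqxx mul1r addr0 (inj_eq q_inj) addrC subrK.
have AU r c : (A *m U) r c = (r == p c)%:R * d - A r (q c).
  transitivity ((A *m \adj A) r (p c) - \sum_s A r s * (s == q c)%:R).
    rewrite !mxE -sumrB; apply: eq_bigr => s _.
    by rewrite !mxE mulrBr.
  rewrite mul_mx_adj mxE mulrC mulr_natr (bigD1 (q c)) //= eqxx mulr1.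
  rewrite big1 ?addr0 // => s /negPf ->.
  by rewrite mulr0.
have AM : A *m M = N *m diag_mx D.
  rewrite mulmxDr mulmx1 mulmxA; apply/matrixP=> r s.
  rewrite mul_mx_diag !mxE; case: pickP => [c /eqP <-|qs].
    rewrite codom_f (bigD1 c) //= big1 => [|b /negPf bc].
      by rewrite AU mxE eqxx mulr1 addr0 addrC subrK.
    by rewrite [V _ _]mxE (inj_eq q_inj) bc mulr0.
  rewrite big1 => [|c _]; last by rewrite [V _ _]mxE qs mulr0.
  case: codomP => [[c sq]|_]; last by rewrite addr0 mulr1.
  by have := qs c; rewrite sq eqxx.
exists (\det N); rewrite -detM /d -det_mulmx AM det_mulmx det_diag.
congr (_ * _); rewrite (eq_bigr (fun s => if s \in codom q then d else 1)).
  by rewrite -big_mkcond prodr_const card_codom // card_ord.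
by move=> s _; rewrite mxE.
Qed.

Lemma det_dvd_adj_minor (R : idomainType) (m : nat) (A : 'M[R]_m)
    (i i' j j' : 'I_m) : j != j' -> \det A != 0 ->
  exists c, cofactor A i j * cofactor A i' j' - cofactor A i j' * cofactor A i' j
            = c * \det A.
Proof.
move=> jj' dA0.
have q_inj : injective (tnth [tuple j; j']).
  by apply/tuple_uniqP; rewrite /= inE jj'.
have [c] := det_mul_adj_minor A (tnth [tuple i; i']) q_inj.
rewrite expr2 mulrA [RHS]mulrC => /(mulfI dA0) minorE.
exists c; rewrite -minorE (expand_det_row _ ord0) !big_ord_recl big_ord0 addr0.
rewrite ![cofactor (mxsub _ _ _) _ _]/cofactor !det_mx11 !mxE /=.
by rewrite expr0 expr1 mul1r mulN1r mulrN [X in _ = _ - X]mulrC.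
Qed.

Section MderivZero.
Variables (R : comNzRingType) (n : nat) (t : 'I_n).
Implicit Types p q : {mpoly R[n]}.

Lemma mderiv1_eq0 : (1 : {mpoly R[n]})^`M(t) = 0.
Proof. by rewrite -mpolyC1 mderivC. Qed.

Lemma mderivM_eq0 p q : p^`M(t) = 0 -> q^`M(t) = 0 -> (p * q)^`M(t) = 0.
Proof. by move=> p0 q0; rewrite mderivM p0 q0 mul0r mulr0 addr0. Qed.

Lemma mderivX_eq0 p e : p^`M(t) = 0 -> (p ^+ e)^`M(t) = 0.
Proof.
move=> p0; elim: e => [|e IHe]; first exact: mderiv1_eq0.
by rewrite exprS; apply: mderivM_eq0.
Qed.

End MderivZero.

(** In the expansion along row [i] all cofactors have zero derivative, as they
    omit the entry at [(i, j)], which is also the only coefficient that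
    contributes. *)
Lemma mderiv_det_single (R : comNzRingType) (n m : nat) (t : 'I_n)
    (A : 'M[{mpoly R[n]}]_m) (i j : 'I_m) :
    (forall a b, (A a b)^`M(t) = ((a, b) == (i, j))%:R) ->
  (\det A)^`M(t) = cofactor A i j.
Proof.
move=> dA.
have d1 := mderiv1_eq0 R t.
have dcof b : (cofactor A i b)^`M(t) = 0.
  have d_sign e : ((-1) ^+ e : {mpoly R[n]})^`M(t) = 0.
    by apply: mderivX_eq0; rewrite mderivN d1 oppr0.
  apply: mderivM_eq0 (d_sign _) _.
  rewrite /determinant raddf_sum big1 // => s _ /=.
  apply: mderivM_eq0 (d_sign _) _.
  elim/big_ind: _ => //; first exact: mderivM_eq0.
  move=> a _; rewrite !mxE dA xpair_eqE.
  by rewrite eq_sym (negPf (neq_lift _ _)).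
rewrite (expand_det_row _ i) raddf_sum (bigD1 j) //= big1 => [|b bj].
  by rewrite mderivM dA dcof eqxx mul1r mulr0 !addr0.
by rewrite mderivM dA dcof xpair_eqE (negPf bj) andbF mul0r mulr0 addr0.
Qed.

Section RestrictedVariables.
Variables (k : fieldType) (T : finType).
Implicit Types (Z : {set T}) (z : T).

Lemma vars_xvar z : vars (xvar k z) = [set z].
Proof.
apply/setP=> w; rewrite !inE /xvar msuppX /= orbF mnm1E.
by rewrite (inj_eq enum_rank_inj) eqb0 negbK eq_sym.
Qed.

Lemma zrestr_xvar Z z : zrestr Z (xvar k z) = zvar k Z z.
Proof. by rewrite /zrestr comp_mpolyXU -tnth_nth tnth_mktuple enum_rankK. Qed.

Lemma mderiv_zvar_neq Z (t : 'I_#|Z|) z :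
  z != enum_val t -> (zvar k Z z)^`M(t) = 0.
Proof.
rewrite /zvar; case: pickP => [u /eqP <-|_ _]; last by rewrite mderiv0.
by rewrite (inj_eq enum_val_inj) mderivX mnm1E => /negPf ->; rewrite scale0r.
Qed.

(** Restriction replaces each variable by itself or by 0, so it cannot create a
    dependence on [t]. *)
Lemma mderiv_zrestr_notin Z (t : 'I_#|Z|) (p : {mpoly k[#|T|]}) :
  enum_val t \notin vars p -> (zrestr Z p)^`M(t) = 0.
Proof.
move=> tp; rewrite /zrestr comp_mpolyEX raddf_sum big1_seq // => e /andP[_ pe].
rewrite /= mderivZ comp_mpolyX.
rewrite (_ : mderiv t _ = 0) ?scaler0 //.
elim/big_ind: _ => [||s _]; [exact: mderiv1_eq0 | exact: mderivM_eq0 |].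
rewrite tnth_mktuple; have [->|es] := eqVneq (e s) 0%N.
  exact: mderiv1_eq0.
apply: mderivX_eq0; apply: mderiv_zvar_neq.
apply: contra tp => /eqP <-; rewrite inE; apply/hasP; exists e => //.
by rewrite enum_valK.
Qed.

End RestrictedVariables.

(** Injectivity of [L] on its variable entries and disjointness of [X1] and
    [X2] leave [(i, j)] as the only position that involves [z], so
    [mderiv_det_single] applies. *)
Lemma mderiv_restr_mx (k : fieldType) (m : nat) (X1 X2 : {set 'I_m * 'I_m})
    (L : 'M[{mpoly k[#|{: 'I_m * 'I_m}|]}]_m) :
    [disjoint X1 & X2] ->
    (forall i j, variable_in X1 (L i j) || linear_form_in X2 (L i j)) ->
    (forall i j i' j' : 'I_m, variable_in X1 (L i j) ->
       variable_in X1 (L i' j') -> (i, j) != (i', j') -> L i j != L i' j') ->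
    forall (i j : 'I_m) (z : 'I_m * 'I_m), z \in X1 -> L i j = xvar k z ->
  polar (\det (restr_mx L)) (zvar k (occurring L) z) =
  quo_class (\det (restr_mx L)) (cofactor (restr_mx L) i j).
Proof.
move=> hX12 hL hinj i j z zX Lij.
have zZ : z \in occurring L.
  apply/bigcupP; exists i => //; apply/bigcupP; exists j => //.
  by rewrite Lij vars_xvar inE.
pose t := enum_rank_in zZ z; have tz : enum_val t = z by rewrite enum_rankK_in.
rewrite -[in LHS]tz zvarE polarX (@mderiv_det_single _ _ _ _ _ i j) // => a b.
rewrite mxE; have [[-> ->]|ab] := eqVneq (a, b) (i, j).
  rewrite Lij zrestr_xvar -tz zvarE mderivX mnm1E eqxx scale1r.
  rewrite (_ : (_ - _)%MM = 0%MM) ?mpolyX0 //.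
  by apply/mnmP => s; rewrite mnmBE subnn mnm0E.
apply: mderiv_zrestr_notin; rewrite tz.
have Lvar : variable_in X1 (L i j) by rewrite Lij; apply: image_f.
have := hL a b; case/orP => [abX | /andP[_ /subsetP ab2]].
  have := hinj _ _ _ _ abX Lvar ab; have /imageP[w _ ->] := abX.
  by rewrite vars_xvar inE Lij; apply: contra => /eqP ->.
by apply/negP => /ab2; apply/negP; rewrite (disjointFr hX12 zX).
Qed.

Theorem theorem1p7 (k : fieldType) (m : nat) (hm : (2 <= m)%N)
    (X1 X2 : {set 'I_m * 'I_m})
    (hX : X1 :|: X2 = [set: 'I_m * 'I_m]) (hX12 : [disjoint X1 & X2])
    (L : 'M[{mpoly k[#|{: 'I_m * 'I_m}|]}]_m)
    (hL : forall i j, variable_in X1 (L i j) || linear_form_in X2 (L i j)) :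
  let Z := occurring L in
  let LA : 'M[{mpoly k[#|Z|]}]_m := restr_mx L in
  let f : {mpoly k[#|Z|]} := \det LA in
  let y : 'I_m * 'I_m -> {mpoly k[#|Z|]} := zvar k Z in
  f != 0 ->
  (exists i j : 'I_m, regular_mod f (\det (row' i (col' j LA)))) ->
  (forall i j i' j' : 'I_m, variable_in X1 (L i j) ->
     variable_in X1 (L i' j') -> (i, j) != (i', j') -> L i j != L i' j') ->
  (forall i i' j j' : 'I_m, (i < i')%N -> (j < j')%N ->
     forall z11 z12 z21 z22 : 'I_m * 'I_m,
     z11 \in X1 -> z12 \in X1 -> z21 \in X1 -> z22 \in X1 ->
     L i j = xvar k z11 -> L i j' = xvar k z12 ->
     L i' j = xvar k z21 -> L i' j' = xvar k z22 ->
     polar f (y z11 * y z22 - y z12 * y z21) = 0) /\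
  (forall P : {mpoly k[#|Z|]},
     ideal_gen (dual_minor (L := L) X1) P -> polar f P = 0).
Proof.
move=> Z LA f y f0 _ hinj.
have minor0 (i i' j j' : 'I_m) z11 z12 z21 z22 : (j < j')%N ->
    z11 \in X1 -> z12 \in X1 -> z21 \in X1 -> z22 \in X1 ->
    L i j = xvar k z11 -> L i j' = xvar k z12 ->
    L i' j = xvar k z21 -> L i' j' = xvar k z22 ->
    polar f (y z11 * y z22 - y z12 * y z21) = 0.
  move=> lt_jj' X11 X12 X21 X22 L11 L12 L21 L22.
  have dE := mderiv_restr_mx hX12 hL hinj.
  rewrite rmorphB !rmorphM /= (dE _ _ _ X11 L11) (dE _ _ _ X12 L12).
  rewrite (dE _ _ _ X21 L21) (dE _ _ _ X22 L22) -!rmorphM -rmorphB.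
  apply/quo_class_eq0; apply: det_dvd_adj_minor => //.
  by rewrite neq_ltn lt_jj'.
split=> [i i' j j' _ lt_jj' z11 z12 z21 z22|P [n [c [g [Sg ->]]]]].
  exact: minor0.
rewrite rmorph_sum big1 // => a _; rewrite rmorphM.
have [i [i' [j [j' [z11 [z12 [z21 [z22]]]]]]]] := Sg a.
case=> [[_ lt_jj'] [X11 X12 X21 X22] [L11 L12 L21 L22] ->].
by rewrite [X in _ * X](minor0 i i' j j') ?mulr0.
Qed.
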